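(* Let $\Sigma$ be a finite signature and $\mathcal{T}$ any $\Sigma$-theory. If $L_1$ and $L_2$ are $\mathcal{T}$-regular $\mathcal{T}$-languages, then their concatenation $L_1\cdot L_2$, i.e. the set of $\mathcal{T}$-words $\bar\sigma$ that can be written as $\bar\sigma=\bar\sigma_1\bar\sigma_2$ (sequence concatenation) with $\bar\sigma_1\in L_1$ and $\bar\sigma_2\in L_2$, is $\mathcal{T}$-regular.
   Context: Signatures are multi-sorted first-order signatures in which every symbol is marked either rigid or non-rigid. For a signature $\Sigma$, $\Sigma'$ denotes the signature obtained from $\Sigma$ by replacing each non-rigid symbol $s$ by a fresh primed copy $s'$ (rigid symbols are kept); for a $\Sigma$-structure $\sigma$, $\sigma'$ denotes the corresponding renamed $\Sigma'$-structure. For structures over pairwise disjoint signatures with the same sort domains, $\rho\cup\sigma\cup\tau'$ denotes the combined structure over the union of the signatures. A $\Sigma$-theory $\mathcal{T}$ is a set of $\Sigma$-sentences; $[\![\mathcal{T}]\!]$ is the set of all $\Sigma$-structures with finite or countably infinite domains that satisfy $\mathcal{T}$. A $\mathcal{T}$-word is a finite sequence $\bar\sigma=\langle\sigma_0,\ldots,\sigma_{n-1}\rangle$ ($n\ge 0$) of elements of $[\![\mathcal{T}]\!]$ such that for every sort $S$ and every rigid symbol $s$ of $\Sigma$, $S^{\sigma_i}=S^{\sigma_j}$ and $s^{\sigma_i}=s^{\sigma_j}$ for all $i,j$. $[\![\mathcal{T}]\!]^*$ is the set of all $\mathcal{T}$-words; a $\mathcal{T}$-language is a subset of $[\![\mathcal{T}]\!]^*$.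 A first-order automaton is a tuple $\mathcal{A}=\langle\Sigma,\Gamma,\phi_0,\phi_T,\phi_F\rangle$ where $\Sigma$ (word signature) and $\Gamma$ (state signature) are finite disjoint signatures, $\phi_0$ and $\phi_F$ are first-order $\Gamma$-sentences, and $\phi_T$ is a first-order $(\Gamma\cup\Sigma\cup\Gamma')$-sentence. Given a $\mathcal{T}$-word $\bar\sigma=\langle\sigma_0,\ldots,\sigma_{n-1}\rangle$, a $\mathcal{T}$-run of $\mathcal{A}$ induced by $\bar\sigma$ is a sequence $\langle\rho_0,\ldots,\rho_n\rangle$ of $\Gamma$-structures such that $S^{\rho_i}=S^{\sigma_0}$ for every sort $S$ and every $i$, rigid symbols of $\Gamma$ are interpreted identically in all $\rho_i$, $\rho_0\models\phi_0$, and $\rho_i\cup\sigma_i\cup\rho'_{i+1}\models\phi_T$ for all $0\le i<n$. $\mathcal{A}$ $\mathcal{T}$-accepts $\bar\sigma$ iff some such run satisfies $\rho_n\models\phi_F$. $\mathcal{L}_{\mathcal{T}}(\mathcal{A})$ is the set of $\mathcal{T}$-words $\mathcal{T}$-accepted by $\mathcal{A}$. A $\mathcal{T}$-language $L$ is $\mathcal{T}$-regular iff $L=\mathcal{L}_{\mathcal{T}}(\mathcal{A})$ for some first-order automaton $\mathcal{A}$ with word signature $\Sigma$. *)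

(* Defs.v *)
From mathcomp Require Import all_boot.
From mathcomp Require Import mathcomp_extra boolp classical_sets functions cardinality.

Set Implicit Arguments.
Unset Strict Implicit.
Unset Printing Implicit Defensive.

Local Open Scope classical_set_scope.

(* Finite signatures over a finite set S of sorts. Constants are function     *)
(* symbols with no argument, propositions are predicate symbols with none.    *)
Record signature (S : finType) := Signature {
  fun_sym : finType;
  farg : fun_sym -> seq S;
  fres : fun_sym -> S;
  frigid : pred fun_sym;
  pred_sym : finType;
  parg : pred_sym -> seq S;
  prigid : pred pred_sym
}.
Arguments farg {S s}.
Arguments fres {S s}.
Arguments frigid {S s}.
Arguments parg {S s}.
Arguments prigid {S s}.

(* Disjointness is built into the sum types; the sorts are shared. *)
Definition sig_union (S : finType) (A B : signature S) : signature S :=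
  {| fun_sym := (fun_sym A + fun_sym B)%type;
     farg := fun f => match f with inl g => farg g | inr g => farg g end;
     fres := fun f => match f with inl g => fres g | inr g => fres g end;
     frigid := fun f => match f with inl g => frigid g | inr g => frigid g end;
     pred_sym := (pred_sym A + pred_sym B)%type;
     parg := fun p => match p with inl q => parg q | inr q => parg q end;
     prigid := fun p => match p with inl q => prigid q | inr q => prigid q end
  |}.

(* Only the fresh part of the primed signature A': the rigid symbols of A'    *)
(* are those of A, so that A `union` A' is sig_union A (sig_primed A).         *)
Definition sig_primed (S : finType) (A : signature S) : signature S :=
  {| fun_sym := {f : fun_sym A | ~~ frigid f};
     farg := fun f => farg (val f);
     fres := fun f => fres (val f);
     frigid := fun=> false;
     pred_sym := {p : pred_sym A | ~~ prigid p};
     parg := fun p => parg (val p);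
     prigid := fun=> false
  |}.

Section Syntax.
Variables (S : finType) (Sg : signature S).

(* Well-sorted de Bruijn variables: the positions of sort s in the context c. *)
Inductive var : seq S -> S -> Type :=
| VarO (s : S) (c : seq S) : var (s :: c) s
| VarS (s t : S) (c : seq S) : var c s -> var (t :: c) s.

Inductive term (c : seq S) : S -> Type :=
| Var (s : S) : var c s -> term c s
| App (f : fun_sym Sg) : terms c (farg f) -> term c (fres f)
with terms (c : seq S) : seq S -> Type :=
| TNil : terms c [::]
| TCons (s : S) (a : seq S) : term c s -> terms c a -> terms c (s :: a).

Inductive formula : seq S -> Type :=
| FFalse (c : seq S) : formula c
| FEq (c : seq S) (s : S) : term c s -> term c s -> formula c
| FPred (c : seq S) (p : pred_sym Sg) : terms c (parg p) -> formula c
| FNot (c : seq S) : formula c -> formula c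
| FAnd (c : seq S) : formula c -> formula c -> formula c
| FOr (c : seq S) : formula c -> formula c -> formula c
| FImp (c : seq S) : formula c -> formula c -> formula c
| FForall (c : seq S) (s : S) : formula (s :: c) -> formula c
| FExists (c : seq S) (s : S) : formula (s :: c) -> formula c.

Definition sentence := formula [::].

Definition theory := set sentence.

End Syntax.

Scheme term_terms_ind := Induction for term Sort Prop
  with terms_term_ind := Induction for terms Sort Prop.

Record domain (S : finType) := Domain {
  carrier :> S -> Type;
  carrier_inhabited : forall s, inhabited (carrier s)
}.

Fixpoint htuple (S : Type) (D : S -> Type) (a : seq S) : Type :=
  if a is s :: a' then (D s * htuple D a')%type else unit.

Record interp (S : finType) (Sg : signature S) (D : domain S) := Interp {
  fint : forall f : fun_sym Sg, htuple D (farg f) -> D (fres f);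
  pint : forall p : pred_sym Sg, htuple D (parg p) -> Prop
}.

Record structure (S : finType) (Sg : signature S) := Structure {
  sdom : domain S;
  sint : interp Sg sdom
}.
Arguments Structure {S Sg sdom}.

Definition interp_union (S : finType) (A B : signature S) (D : domain S)
    (I : interp A D) (J : interp B D) : interp (sig_union A B) D :=
  @Interp S (sig_union A B) D
    (fun f => match f with inl g => fint I (f := g) | inr g => fint J (f := g) end)
    (fun p => match p with inl q => pint I (p := q) | inr q => pint J (p := q) end).

Definition interp_primed (S : finType) (A : signature S) (D : domain S)
    (I : interp A D) : interp (sig_primed A) D :=
  @Interp S (sig_primed A) D
    (fun f => fint I (f := val f)) (fun p => pint I (p := val p)).

Section Semantics.
Variables (S : finType) (Sg : signature S) (D : domain S) (I : interp Sg D).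

Fixpoint lookup (c : seq S) (s : S) (x : var c s) : htuple D c -> D s :=
  match x in var c s return htuple D c -> D s with
  | VarO _ _ => fun e => e.1
  | VarS _ _ _ y => fun e => lookup y e.2
  end.

Fixpoint eval (c : seq S) (e : htuple D c) (s : S) (t : term Sg c s) : D s :=
  match t in term _ _ s return D s with
  | Var _ x => lookup x e
  | App f ts => fint I (evals e ts)
  end
with evals (c : seq S) (e : htuple D c) (a : seq S) (ts : terms Sg c a) :
    htuple D a :=
  match ts in terms _ _ a return htuple D a with
  | TNil => tt
  | TCons _ _ t ts' => (eval e t, evals e ts')
  end.

Fixpoint sat (c : seq S) (phi : formula Sg c) : htuple D c -> Prop :=
  match phi in formula _ c return htuple D c -> Prop with
  | FFalse _ => fun=> False
  | FEq _ _ t u => fun e => eval e t = eval e u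
  | FPred _ _ ts => fun e => pint I (evals e ts)
  | FNot _ a => fun e => ~ sat a e
  | FAnd _ a b => fun e => sat a e /\ sat b e
  | FOr _ a b => fun e => sat a e \/ sat b e
  | FImp _ a b => fun e => sat a e -> sat b e
  | FForall _ s a => fun e => forall d : D s, sat a (d, e)
  | FExists _ s a => fun e => exists d : D s, sat a (d, e)
  end.

Definition holds (phi : sentence Sg) : Prop := sat phi tt.

End Semantics.

Definition models (S : finType) (Sg : signature S) (T : theory Sg) :
    set (structure Sg) :=
  [set M | (forall s, countable [set: sdom M s]) /\
           forall phi, T phi -> holds (sint M) phi].

Definition rigid_agree (S : finType) (Sg : signature S) (D : domain S)
    (I J : interp Sg D) : Prop :=
  (forall f : fun_sym Sg, frigid f -> fint I (f := f) = fint J (f := f)) /\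
  (forall p : pred_sym Sg, prigid p -> pint I (p := p) = pint J (p := p)).

(* The sequence of structures w has all its domains equal to D, and sigma     *)
(* lists its interpretations; sigma i is irrelevant for i >= size w. For      *)
(* w = [::] this holds of every D.                                            *)
Definition presents (S : finType) (Sg : signature S) (D : domain S)
    (sigma : nat -> interp Sg D) (w : seq (structure Sg)) : Prop :=
  w = mkseq (fun i => Structure (sigma i)) (size w).

Definition words (S : finType) (Sg : signature S) (T : theory Sg) :
    set (seq (structure Sg)) :=
  [set w | exists (D : domain S) (sigma : nat -> interp Sg D),
     [/\ presents sigma w,
         forall i, i < size w -> models T (Structure (sigma i)) &
         forall i j, i < size w -> j < size w ->
           rigid_agree (sigma i) (sigma j)]].

Definition is_language (S : finType) (Sg : signature S) (T : theory Sg)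
    (L : set (seq (structure Sg))) : Prop := L `<=` words T.

Definition trans_sig (S : finType) (G Sg : signature S) : signature S :=
  sig_union (sig_union G Sg) (sig_primed G).

Definition trans_interp (S : finType) (G Sg : signature S) (D : domain S)
    (rho : interp G D) (sigma : interp Sg D) (tau : interp G D) :
    interp (trans_sig G Sg) D :=
  interp_union (interp_union rho sigma) (interp_primed tau).

Record automaton (S : finType) (Sg : signature S) := Automaton {
  astate : signature S;
  ainit : sentence astate;
  atrans : sentence (trans_sig astate Sg);
  afinal : sentence astate
}.

Section Runs.
Variables (S : finType) (Sg : signature S) (A : automaton Sg).

Definition is_run (D : domain S) (n : nat) (sigma : nat -> interp Sg D)
    (rho : nat -> interp (astate A) D) : Prop :=
  [/\ forall i j, i <= n -> j <= n -> rigid_agree (rho i) (rho j),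
      holds (rho 0) (ainit A) &
      forall i, i < n ->
        holds (trans_interp (rho i) (sigma i) (rho i.+1)) (atrans A)].

Definition accepts (w : seq (structure Sg)) : Prop :=
  exists (D : domain S) (sigma : nat -> interp Sg D)
         (rho : nat -> interp (astate A) D),
    [/\ presents sigma w, is_run (size w) sigma rho &
        holds (rho (size w)) (afinal A)].

Definition lang (T : theory Sg) : set (seq (structure Sg)) :=
  [set w | words T w /\ accepts w].

End Runs.

Definition regular (S : finType) (Sg : signature S) (T : theory Sg)
    (L : set (seq (structure Sg))) : Prop :=
  exists A : automaton Sg, L = lang A T.

Definition concat (S : finType) (Sg : signature S) (T : theory Sg)
    (L1 L2 : set (seq (structure Sg))) : set (seq (structure Sg)) :=
  [set w | words T w /\
     exists w1 w2, [/\ w = w1 ++ w2, L1 w1 & L2 w2]].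

(* Main.v *)
Require Import Defs.
From mathcomp Require Import all_boot.
From mathcomp Require Import mathcomp_extra boolp classical_sets functions cardinality.

(** The automaton for the concatenation carries the states of both automata
    and a flexible proposition, the phase, telling which of the two is active.
    It moves to the second phase while reading the last letter of the first
    factor, when the successor state is both final for the first automaton and
    initial for the second.  If one factor is empty, the domain on which its
    acceptance is witnessed need not be the domain of the word; whether the
    empty word belongs to each language is therefore hard-wired into the
    automaton as a boolean. *)

Set Implicit Arguments.
Unset Strict Implicit.
Unset Printing Implicit Defensive.

Local Open Scope classical_set_scope.

(** * Translations between signatures *)

(* Images are given as operations on argument lists over the target, so that
   no cast between arities is needed. *)
Record translation (S : finType) (A B : signature S) := Translation {
  tr_fun : forall (f : fun_sym A) c, terms B c (farg f) -> term B c (fres f);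
  tr_pred : forall (p : pred_sym A) c, terms B c (parg p) -> formula B c
}.

Section Translate.
Variables (S : finType) (A B : signature S) (F : translation A B).

Fixpoint tr_term c s (t : term A c s) : term B c s :=
  match t in term _ _ s return term B c s with
  | Var _ x => Var B x
  | App f ts => tr_fun F (tr_terms ts)
  end
with tr_terms c a (ts : terms A c a) : terms B c a :=
  match ts in terms _ _ a return terms B c a with
  | TNil => TNil B c
  | TCons _ _ t ts' => TCons (tr_term t) (tr_terms ts')
  end.

Fixpoint tr_formula c (phi : formula A c) : formula B c :=
  match phi in formula _ c return formula B c with
  | FFalse c => FFalse B c
  | FEq _ _ t u => FEq (tr_term t) (tr_term u)
  | FPred _ _ ts => tr_pred F (tr_terms ts)
  | FNot _ a => FNot (tr_formula a)
  | FAnd _ a b => FAnd (tr_formula a) (tr_formula b)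
  | FOr _ a b => FOr (tr_formula a) (tr_formula b)
  | FImp _ a b => FImp (tr_formula a) (tr_formula b)
  | FForall _ _ a => FForall (tr_formula a)
  | FExists _ _ a => FExists (tr_formula a)
  end.

Variables (D : domain S) (I : interp A D) (J : interp B D).

(** Symbolwise correctness, quantified over all target argument lists since [tr_term] feeds already
    translated arguments to [tr_fun]. *)
Definition translates : Prop :=
  (forall (f : fun_sym A) c (e : htuple D c) (ts : terms B c (farg f)),
     eval J e (tr_fun F ts) = fint I (evals J e ts)) /\
  (forall (p : pred_sym A) c (e : htuple D c) (ts : terms B c (parg p)),
     sat J (tr_pred F ts) e <-> pint I (evals J e ts)).

Hypothesis trF : translates.

Lemma eval_tr c (e : htuple D c) s (t : term A c s) :
  eval J e (tr_term t) = eval I e t.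
Proof.
move: s t; apply: (term_terms_ind
  (P := fun s t => eval J e (tr_term t) = eval I e t)
  (P0 := fun a ts => evals J e (tr_terms ts) = evals I e ts)) => //=.
- by move=> f ts IH; rewrite trF.1 IH.
- by move=> s a t -> ts ->.
Qed.

Lemma evals_tr c (e : htuple D c) a (ts : terms A c a) :
  evals J e (tr_terms ts) = evals I e ts.
Proof. by elim: ts => //= s a' t ts ->; rewrite eval_tr. Qed.

(** [I] and [J] share the domain [D], so variables and quantifiers carry over unchanged and only the
    symbols have to be checked. *)
Lemma sat_tr c (phi : formula A c) (e : htuple D c) :
  sat J (tr_formula phi) e <-> sat I phi e.
Proof.
elim: phi e => {c} [c|c s t u|c p ts|c a IH|c a IHa b IHb|c a IHa b IHb
  |c a IHa b IHb|c s a IH|c s a IH] e //=.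
- by rewrite !eval_tr.
- by rewrite trF.2 evals_tr.
- by rewrite IH.
- by rewrite IHa IHb.
- by rewrite IHa IHb.
- by rewrite IHa IHb.
- by split=> h d; apply/IH.
- by split=> -[d h]; exists d; apply/IH.
Qed.

End Translate.

(** * Inclusions into a disjoint union *)

Section Inclusions.
Variables (S : finType) (A B : signature S).

Definition tr_inl : translation A (sig_union A B) :=
  @Translation S A (sig_union A B)
    (fun f c ts => @App S (sig_union A B) c (inl f) ts)
    (fun p c ts => @FPred S (sig_union A B) c (inl p) ts).

Definition tr_inr : translation B (sig_union A B) :=
  @Translation S B (sig_union A B)
    (fun f c ts => @App S (sig_union A B) c (inr f) ts)
    (fun p c ts => @FPred S (sig_union A B) c (inr p) ts).

Lemma tr_inlP D (I : interp A D) (J : interp B D) :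
  translates tr_inl I (interp_union I J).
Proof. by []. Qed.

Lemma tr_inrP D (I : interp A D) (J : interp B D) :
  translates tr_inr J (interp_union I J).
Proof. by []. Qed.

End Inclusions.

(** * Formulas about successor states and transitions *)

Section TransTranslations.
Variables (S : finType) (Sg : signature S).

Section Next.
Variable G : signature S.
Let B := trans_sig G Sg.

(* Rigid symbols have no primed copy, so they are read in the source state. *)
Definition next_fun (f : fun_sym G) c :
    terms B c (farg f) -> term B c (fres f) :=
  match decP (@idP (~~ frigid f)) with
  | left h => fun ts => @App S B c (inr (exist _ f h)) ts
  | right _ => fun ts => @App S B c (inl (inl f)) ts
  end.

Definition next_pred (p : pred_sym G) c : terms B c (parg p) -> formula B c :=
  match decP (@idP (~~ prigid p)) with
  | left h => fun ts => @FPred S B c (inr (exist _ p h)) ts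
  | right _ => fun ts => @FPred S B c (inl (inl p)) ts
  end.

Definition tr_next : translation G B := Translation next_fun next_pred.

(** Flexible symbols are read in the primed copy, hence in [tau]; rigid ones are read in [rho], and
    [rigid_agree] gives them the same value in [tau]. *)
Lemma tr_nextP D (rho tau : interp G D) (sigma : interp Sg D) :
  rigid_agree rho tau -> translates tr_next tau (trans_interp rho sigma tau).
Proof.
move=> [agf agp]; split.
- move=> f c e ts /=; rewrite /next_fun.
  by case: decP => //= /negP/negbNE h; rewrite agf.
- move=> p c e ts /=; rewrite /next_pred.
  by case: decP => //= /negP/negbNE h; rewrite agp.
Qed.

End Next.

Variables G H : signature S.

(** Rigidity in the union is computed componentwise, so [valP g] also proves that the image of a
    primed symbol is flexible. *)
Definition tr_trans_inl :
    translation (trans_sig G Sg) (trans_sig (sig_union G H) Sg) :=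
  let B := trans_sig (sig_union G H) Sg in
  @Translation S (trans_sig G Sg) B
    (fun f c => match f return
         terms B c (farg (s := trans_sig G Sg) f) ->
         term B c (fres (s := trans_sig G Sg) f) with
       | inl (inl g) => fun ts => @App S B c (inl (inl (inl g))) ts
       | inl (inr g) => fun ts => @App S B c (inl (inr g)) ts
       | inr g => fun ts =>
           @App S B c (inr (exist _ (inl (val g)) (valP g))) ts
       end)
    (fun p c => match p return
         terms B c (parg (s := trans_sig G Sg) p) -> formula B c with
       | inl (inl q) => fun ts => @FPred S B c (inl (inl (inl q))) ts
       | inl (inr q) => fun ts => @FPred S B c (inl (inr q)) ts
       | inr q => fun ts =>
           @FPred S B c (inr (exist _ (inl (val q)) (valP q))) ts
       end).

Definition tr_trans_inr :
    translation (trans_sig H Sg) (trans_sig (sig_union G H) Sg) :=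
  let B := trans_sig (sig_union G H) Sg in
  @Translation S (trans_sig H Sg) B
    (fun f c => match f return
         terms B c (farg (s := trans_sig H Sg) f) ->
         term B c (fres (s := trans_sig H Sg) f) with
       | inl (inl g) => fun ts => @App S B c (inl (inl (inr g))) ts
       | inl (inr g) => fun ts => @App S B c (inl (inr g)) ts
       | inr g => fun ts =>
           @App S B c (inr (exist _ (inr (val g)) (valP g))) ts
       end)
    (fun p c => match p return
         terms B c (parg (s := trans_sig H Sg) p) -> formula B c with
       | inl (inl q) => fun ts => @FPred S B c (inl (inl (inr q))) ts
       | inl (inr q) => fun ts => @FPred S B c (inl (inr q)) ts
       | inr q => fun ts =>
           @FPred S B c (inr (exist _ (inr (val q)) (valP q))) ts
       end).

Lemma tr_trans_inlP D (r1 t1 : interp G D) (r2 t2 : interp H D)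
    (sigma : interp Sg D) :
  translates tr_trans_inl (trans_interp r1 sigma t1)
    (trans_interp (interp_union r1 r2) sigma (interp_union t1 t2)).
Proof. by split=> [[[f|f]|f]|[[p|p]|p]]. Qed.

Lemma tr_trans_inrP D (r1 t1 : interp G D) (r2 t2 : interp H D)
    (sigma : interp Sg D) :
  translates tr_trans_inr (trans_interp r2 sigma t2)
    (trans_interp (interp_union r1 r2) sigma (interp_union t1 t2)).
Proof. by split=> [[[f|f]|f]|[[p|p]|p]]. Qed.

End TransTranslations.

(** * Words *)

Section Words.
Variables (S : finType) (Sg : signature S).

(** The equality yields [I = J] only up to transport along some proof of [D = D]; proof irrelevance
    turns that proof into [erefl]. *)
Lemma Structure_inj (D : domain S) (I J : interp Sg D) :
  Structure I = Structure J -> I = J.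
Proof.
move=> e.
have cast (M N : structure Sg) (h : M = N) :
    eq_rect _ (interp Sg) (sint M) _ (f_equal (@sdom S Sg) h) = sint N.
  by destruct h.
by have := cast _ _ e; rewrite (Prop_irrelevance (f_equal (@sdom S Sg) e) (erefl D)).
Qed.

Lemma nth_presents (D : domain S) (sigma : nat -> interp Sg D) w M i :
  presents sigma w -> i < size w -> nth M w i = Structure (sigma i).
Proof. by move=> -> ; rewrite size_mkseq => ilt; rewrite nth_mkseq. Qed.

Lemma presents_cat (D : domain S) (sigma : nat -> interp Sg D) w1 w2 :
  presents sigma (w1 ++ w2) <->
  presents sigma w1 /\ presents (fun i => sigma (size w1 + i)) w2.
Proof.
have mk : mkseq (fun i => Structure (sigma i)) (size (w1 ++ w2)) =
    mkseq (fun i => Structure (sigma i)) (size w1) ++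
    mkseq (fun i => Structure (sigma (size w1 + i))) (size w2).
  by rewrite size_cat /mkseq iotaD map_cat add0n -[in iota (size w1)](addn0 (size w1)) iotaDl -map_comp.
rewrite /presents mk; split=> [e|[<- <-]] //; split.
- by move: (congr1 (take (size w1)) e); rewrite !take_size_cat ?size_mkseq.
- by move: (congr1 (drop (size w1)) e); rewrite !drop_size_cat ?size_mkseq.
Qed.

Lemma words_cat (T : theory Sg) w1 w2 :
  words T (w1 ++ w2) -> words T w1 /\ words T w2.
Proof.
move=> [D [sigma [/presents_cat[p1 p2] mods ag]]].
rewrite size_cat in mods ag; split.
- exists D, sigma; split=> // [i i1|i j i1 j1]; first exact/mods/ltn_addr.
  by apply: ag; apply: ltn_addr.
- exists D, (fun i => sigma (size w1 + i)); split=> // [i i2|i j i2 j2].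
    by apply: mods; rewrite ltn_add2l.
  by apply: ag; rewrite ltn_add2l.
Qed.

Lemma is_run_ext (A : automaton Sg) (D : domain S) n
    (s t : nat -> interp Sg D) (rho : nat -> interp (astate A) D) :
  (forall i, i < n -> s i = t i) -> is_run n s rho -> is_run n t rho.
Proof.
by move=> st [ag ini tr]; split=> // i ilt; rewrite -st //; apply: tr.
Qed.

(* A nonempty word determines its domain and its interpretations. *)
Lemma accepts_presented (A : automaton Sg) (D : domain S)
    (sigma : nat -> interp Sg D) w :
  accepts A w -> 0 < size w -> presents sigma w ->
  exists rho, is_run (A := A) (size w) sigma rho /\
              holds (rho (size w)) (afinal A).
Proof.
move=> [D1 [sigma1 [rho [p1 run fin]]]] w0 p.
have e i (ilt : i < size w) : Structure (sigma1 i) = Structure (sigma i).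
  rewrite -(nth_presents (Structure (sigma i)) p1 ilt).
  by rewrite (nth_presents _ p ilt).
(* The letter at position 0 exists because [w] is nonempty; its domain identifies [D1] with [D]. *)
have eD : D1 = D by case: (f_equal (@sdom S Sg) (e 0 w0)).
case: _ / eD sigma p e => sigma p e.
exists rho; split=> //; apply: is_run_ext run => i ilt.
exact/Structure_inj/e.
Qed.

End Words.

(** * The concatenation automaton *)

Section Concat.
Variables (S : finType) (Sg : signature S) (A1 A2 : automaton Sg).
Variables eps1 eps2 : bool.

Let G1 := astate A1.
Let G2 := astate A2.

Definition phase_sig : signature S :=
  {| fun_sym := void;
     farg := fun=> [::];
     fres := fun f => match f with end;
     frigid := fun=> false;
     pred_sym := unit;
     parg := fun=> [::];
     prigid := fun=> false
  |}.

Definition phase_interp (D : domain S) (P : Prop) : interp phase_sig D :=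
  @Interp S phase_sig D (fun f => match f with end) (fun _ _ => P).

Definition phase : sentence phase_sig :=
  @FPred S phase_sig [::] tt (TNil phase_sig [::]).

Definition concat_sig := sig_union (sig_union G1 G2) phase_sig.

Definition concat_interp (D : domain S) (r1 : interp G1 D) (r2 : interp G2 D)
    (P : Prop) : interp concat_sig D :=
  interp_union (interp_union r1 r2) (phase_interp D P).

Definition in_state1 (phi : sentence G1) : sentence concat_sig :=
  tr_formula (tr_inl _ _) (tr_formula (tr_inl _ _) phi).
Definition in_state2 (phi : sentence G2) : sentence concat_sig :=
  tr_formula (tr_inl _ _) (tr_formula (tr_inr _ _) phi).
Definition in_phase2 : sentence concat_sig := tr_formula (tr_inr _ _) phase.

Definition now (phi : sentence concat_sig) :
    sentence (trans_sig concat_sig Sg) :=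
  tr_formula (tr_inl _ _) (tr_formula (tr_inl _ _) phi).
Definition next (phi : sentence concat_sig) :
    sentence (trans_sig concat_sig Sg) := tr_formula (tr_next Sg _) phi.
Definition step1 : sentence (trans_sig concat_sig Sg) :=
  tr_formula (tr_trans_inl _ _ _)
    (tr_formula (tr_trans_inl _ _ _) (atrans A1)).
Definition step2 : sentence (trans_sig concat_sig Sg) :=
  tr_formula (tr_trans_inl _ _ _)
    (tr_formula (tr_trans_inr _ _ _) (atrans A2)).

Definition cst (B : signature S) (b : bool) : sentence B :=
  if b then FNot (FFalse B [::]) else FFalse B [::].

(** The disjuncts guarded by [eps1] and [eps2] allow starting in phase 2 or ending in phase 1, the
    cases of an empty factor. Phase 2 is never left, since its transitions demand it of the
    successor too. *)
Definition concat_automaton : automaton Sg :=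
  {| astate := concat_sig;
     ainit := FOr (FAnd (FNot in_phase2) (in_state1 (ainit A1)))
                  (FAnd (cst _ eps1)
                        (FAnd in_phase2 (in_state2 (ainit A2))));
     atrans :=
       FOr (FAnd (FNot (now in_phase2))
                 (FAnd step1
                    (FImp (next in_phase2)
                       (FAnd (next (in_state1 (afinal A1)))
                             (next (in_state2 (ainit A2)))))))
           (FAnd (now in_phase2) (FAnd (next in_phase2) step2));
     afinal := FOr (FAnd in_phase2 (in_state2 (afinal A2)))
                   (FAnd (cst _ eps2)
                         (FAnd (FNot in_phase2) (in_state1 (afinal A1))))
  |}.

(** * Meaning of the formulas of the automaton *)

Lemma holds_cst (B : signature S) (D : domain S) (I : interp B D) b :
  holds I (cst B b) <-> b.
Proof. by case: b; split=> // _ []. Qed.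

Lemma holds_in_state1 (D : domain S) (r1 : interp G1 D) (r2 : interp G2 D)
    (P : Prop) phi :
  holds (concat_interp r1 r2 P) (in_state1 phi) <-> holds r1 phi.
Proof.
by rewrite /holds (sat_tr (tr_inlP _ _)) (sat_tr (tr_inlP _ _)).
Qed.

Lemma holds_in_state2 (D : domain S) (r1 : interp G1 D) (r2 : interp G2 D)
    (P : Prop) phi :
  holds (concat_interp r1 r2 P) (in_state2 phi) <-> holds r2 phi.
Proof.
by rewrite /holds (sat_tr (tr_inlP _ _)) (sat_tr (tr_inrP _ _)).
Qed.

Section Holds.
Variables (D : domain S) (sigma : interp Sg D).
Variables (r1 t1 : interp G1 D) (r2 t2 : interp G2 D) (P Q : Prop).

(** The phase is flexible, so [P] and [Q] are unrelated. *)
Lemma rigid_agree_concat :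
  rigid_agree (concat_interp r1 r2 P) (concat_interp t1 t2 Q) <->
  rigid_agree r1 t1 /\ rigid_agree r2 t2.
Proof.
split=> [[agf agp]|[[agf1 agp1] [agf2 agp2]]].
- split; split.
  + by move=> f; apply: (agf (inl (inl f))).
  + by move=> p; apply: (agp (inl (inl p))).
  + by move=> f; apply: (agf (inl (inr f))).
  + by move=> p; apply: (agp (inl (inr p))).
- by split=> [[[f|f]|[]]|[[p|p]|[]]] //;
    [apply: agf1|apply: agf2|apply: agp1|apply: agp2].
Qed.

Lemma holds_concat_init :
  holds (concat_interp r1 r2 P) (ainit concat_automaton) <->
  (~ P /\ holds r1 (ainit A1)) \/ [/\ eps1, P & holds r2 (ainit A2)].
Proof.
have := holds_in_state1 r1 r2 P (ainit A1).
have := holds_in_state2 r1 r2 P (ainit A2).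
have := holds_cst (concat_interp r1 r2 P) eps1.
rewrite /holds /= => -> -> ->.
by split=> -[[]|[]]; try tauto; right; split; tauto.
Qed.

Lemma holds_concat_final :
  holds (concat_interp r1 r2 P) (afinal concat_automaton) <->
  (P /\ holds r2 (afinal A2)) \/ [/\ eps2, ~ P & holds r1 (afinal A1)].
Proof.
have := holds_in_state1 r1 r2 P (afinal A1).
have := holds_in_state2 r1 r2 P (afinal A2).
have := holds_cst (concat_interp r1 r2 P) eps2.
rewrite /holds /= => -> -> ->.
by split=> -[[]|[]]; try tauto; right; split; tauto.
Qed.

(** Rigid agreement is what makes [next] speak about the successor state, by [tr_nextP]. *)
Lemma holds_concat_trans :
  rigid_agree r1 t1 -> rigid_agree r2 t2 ->
  holds (trans_interp (concat_interp r1 r2 P) sigma (concat_interp t1 t2 Q))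
    (atrans concat_automaton) <->
  [/\ ~ P, holds (trans_interp r1 sigma t1) (atrans A1) &
      Q -> holds t1 (afinal A1) /\ holds t2 (ainit A2)] \/
  [/\ P, Q & holds (trans_interp r2 sigma t2) (atrans A2)].
Proof.
move=> ag1 ag2.
set J := trans_interp _ _ _.
have nextE phi : holds J (next phi) <-> holds (concat_interp t1 t2 Q) phi.
  by rewrite /holds (sat_tr (tr_nextP _ _)) //; apply/rigid_agree_concat.
have s1E : holds J step1 <-> holds (trans_interp r1 sigma t1) (atrans A1).
  by rewrite /holds (sat_tr (tr_trans_inlP _ _ _ _ _))
    (sat_tr (tr_trans_inlP _ _ _ _ _)).
have s2E : holds J step2 <-> holds (trans_interp r2 sigma t2) (atrans A2).
  by rewrite /holds (sat_tr (tr_trans_inlP _ _ _ _ _))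
    (sat_tr (tr_trans_inrP _ _ _ _ _)).
have f1 := iff_trans (nextE (in_state1 (afinal A1)))
  (holds_in_state1 t1 t2 Q (afinal A1)).
have i2 := iff_trans (nextE (in_state2 (ainit A2)))
  (holds_in_state2 t1 t2 Q (ainit A2)).
move: f1 i2 s1E s2E; rewrite /holds /=.
move=> -> -> -> ->.
split=> [[[? [? ?]]|[? [? ?]]]|[[? ? ?]|[? ? ?]]]; try tauto.
- by left.
- by right.
Qed.

End Holds.

(** * Components of a state *)

Definition state1 (D : domain S) (rho : interp concat_sig D) : interp G1 D :=
  @Interp S G1 D (fun f => fint rho (f := inl (inl f)))
                 (fun p => pint rho (p := inl (inl p))).
Definition state2 (D : domain S) (rho : interp concat_sig D) : interp G2 D :=
  @Interp S G2 D (fun f => fint rho (f := inl (inr f)))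
                 (fun p => pint rho (p := inl (inr p))).
Definition phase_of (D : domain S) (rho : interp concat_sig D) : Prop :=
  pint rho (p := inr tt) tt.

Lemma concat_interp_eta (D : domain S) (rho : interp concat_sig D) :
  concat_interp (state1 rho) (state2 rho) (phase_of rho) = rho.
Proof.
case: rho => fi pi; congr Interp.
- by apply: functional_extensionality_dep => -[[f|f]|[]].
- apply: functional_extensionality_dep => -[[p|p]|[]] //=.
  by apply/funext => -[].
Qed.

(** * Accepting runs built from runs of the factors *)

Definition default_interp (G : signature S) (D : domain S) : interp G D :=
  @Interp S G D (fun f _ => inhabited_witness (carrier_inhabited D (fres f)))
                (fun _ _ => True).

Lemma accepts_concat1 w : eps2 -> accepts A1 w -> accepts concat_automaton w.
Proof.
move=> e2 [D [sigma [rho [pw [ag ini tr] fin]]]].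
(* The run stays in phase 1, and [eps2] lets it end there. The idle second component is constant in
   time, so its rigid symbols agree. *)
exists D, sigma, (fun i => concat_interp (rho i) (default_interp G2 D) False).
split=> //; last by apply/holds_concat_final; right; split.
split=> [i j ilt jlt||i ilt].
- by apply/rigid_agree_concat; split=> //; apply: ag.
- by apply/holds_concat_init; left; split.
- apply/holds_concat_trans => //; first by apply: ag => //; apply: ltnW.
  by left; split=> //; apply: tr.
Qed.

Lemma accepts_concat2 w : eps1 -> accepts A2 w -> accepts concat_automaton w.
Proof.
move=> e1 [D [sigma [rho [pw [ag ini tr] fin]]]].
exists D, sigma, (fun i => concat_interp (default_interp G1 D) (rho i) True).
split=> //; last by apply/holds_concat_final; left.
split=> [i j ilt jlt||i ilt].
- by apply/rigid_agree_concat; split=> //; apply: ag.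
- by apply/holds_concat_init; right; split.
- apply/holds_concat_trans => //; first by apply: ag => //; apply: ltnW.
  by right; split=> //; apply: tr.
Qed.

(** As both factors are nonempty, [accepts_presented] brings their runs to the domain and
    interpretations of the whole word, where they can be glued. *)
Lemma accepts_concat_cat (T : theory Sg) w1 w2 :
  words T (w1 ++ w2) -> 0 < size w1 -> 0 < size w2 ->
  accepts A1 w1 -> accepts A2 w2 -> accepts concat_automaton (w1 ++ w2).
Proof.
move=> [D [sigma [pw _ _]]] n1_gt0 n2_gt0 acc1 acc2.
have [p1 p2] := (presents_cat _ _ _).1 pw.
have [rho1 [[ag1 ini1 tr1] fin1]] := accepts_presented acc1 n1_gt0 p1.
have [rho2 [[ag2 ini2 tr2] fin2]] := accepts_presented acc2 n2_gt0 p2.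
set n1 := size w1 in n1_gt0 ag1 tr1 fin1 tr2 *.
exists D, sigma.
(* The first component is frozen at its last state from time [n1] on; truncated subtraction keeps
   the second at its initial state until then. The phase is 2 from time [n1] on. *)
exists (fun i => concat_interp (rho1 (minn i n1)) (rho2 (i - n1)) (n1 <= i)).
have ag i j : i <= n1 + size w2 -> j <= n1 + size w2 ->
    rigid_agree (rho1 (minn i n1)) (rho1 (minn j n1)) /\
    rigid_agree (rho2 (i - n1)) (rho2 (j - n1)).
  by move=> ile jle; split; [apply: ag1; rewrite geq_minr
                            |apply: ag2; rewrite leq_subLR].
rewrite size_cat -/n1; split=> //; last first.
  by apply/holds_concat_final; left; rewrite leq_addr addKn.
split=> [i j ilt jlt||i ilt].
- exact/rigid_agree_concat/ag.
- by apply/holds_concat_init; left; rewrite leqNgt n1_gt0 min0n.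
- have [a1 a2] := ag i i.+1 (ltnW ilt) ilt.
  apply/holds_concat_trans => //; case: (ltnP i n1) => [lt1|ge1].
    left; rewrite (minn_idPl lt1); split=> //.
      exact: tr1.
    (* Only the step reading the last letter of [w1] changes the phase; its target pairs the final
       [rho1 n1] with the initial [rho2 0]. *)
    move=> ge1; have -> : i.+1 = n1 by apply/eqP; rewrite eqn_leq lt1.
    by rewrite subnn.
  right; rewrite (leq_trans ge1) // subSn //; split=> //.
  (* Letter [i] of the word is letter [i - n1] of [w2], which [tr2] writes as
     [sigma (n1 + (i - n1))]. *)
  rewrite -{2}(subnKC ge1); apply: tr2.
  by rewrite ltn_subLR.
Qed.

(** * Cutting an accepting run at the change of phase *)

Lemma accepts_concat_inv w : accepts concat_automaton w ->
  [\/ eps2 /\ accepts A1 w, eps1 /\ accepts A2 w |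
      exists w1 w2, [/\ w = w1 ++ w2, accepts A1 w1 & accepts A2 w2]].
Proof.
move=> [D [sigma [rho [pw [ag ini tr] fin]]]].
set n := size w in ag ini tr fin.
pose r1 i := state1 (rho i); pose r2 i := state2 (rho i).
pose P i := phase_of (rho i).
have rhoE i : rho i = concat_interp (r1 i) (r2 i) (P i).
  by rewrite concat_interp_eta.
have ag12 i j : i <= n -> j <= n ->
    rigid_agree (r1 i) (r1 j) /\ rigid_agree (r2 i) (r2 j).
  by move=> ile jle; move: (ag i j ile jle); rewrite !rhoE rigid_agree_concat.
have ag1 i j ile jle := (ag12 i j ile jle).1.
have ag2 i j ile jle := (ag12 i j ile jle).2.
have {}tr i : i < n ->
    [/\ ~ P i, holds (trans_interp (r1 i) (sigma i) (r1 i.+1)) (atrans A1) &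
      P i.+1 -> holds (r1 i.+1) (afinal A1) /\ holds (r2 i.+1) (ainit A2)] \/
    [/\ P i, P i.+1 &
      holds (trans_interp (r2 i) (sigma i) (r2 i.+1)) (atrans A2)].
  move=> ilt; have := tr i ilt; rewrite !rhoE => /holds_concat_trans; apply.
    by apply: ag1 => //; apply: ltnW.
  by apply: ag2 => //; apply: ltnW.
(* Phase 2 persists, so the phase changes at most once. *)
have up i j : i <= j -> j <= n -> P i -> P j.
  move=> ij jn Pi; elim: j ij jn => [|j IH]; first by rewrite leqn0 => /eqP <-.
  rewrite leq_eqVlt => /predU1P[<- //|ij] jn; have Pj := IH ij (ltnW jn).
  by case: (tr _ jn) => -[].
have tr1 i : i < n -> ~ P i ->
    holds (trans_interp (r1 i) (sigma i) (r1 i.+1)) (atrans A1).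
  by move=> ilt nP; case: (tr _ ilt) => -[].
have tr2 i : i < n -> P i ->
    holds (trans_interp (r2 i) (sigma i) (r2 i.+1)) (atrans A2).
  by move=> ilt nP; case: (tr _ ilt) => -[].
move: ini fin; rewrite !rhoE holds_concat_init holds_concat_final.
case=> [[nP0 ini1]|[e1 P0 ini2]]; last first.
  (* Starting in phase 2, the run stays there and its second component is a run of [A2] on all of
     [w]. *)
  have allP i : i <= n -> P i by move=> ile; apply: (up 0).
  case=> [[_ fin2]|[_ nPn]]; last by case: nPn; apply: allP.
  apply: Or32; split=> //; exists D, sigma, r2; split=> //; split=> // i ilt.
  by apply: tr2 => //; apply/allP/ltnW.
case=> [[Pn fin2]|[e2 nPn fin1]]; last first.
  (* Ending in phase 1 excludes phase 2 at every earlier time, so the first component is a run of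
     [A1] on all of [w]. *)
  apply: Or31; split=> //; exists D, sigma, r1; split=> //; split=> // i ilt.
  by apply: tr1 => // Pi; apply: nPn; apply: up Pi => //; apply: ltnW.
(* Otherwise the word is cut at the least time in phase 2; [asbool] makes the predicate boolean for
   [ex_minnP]. *)
have exP : exists m, `[< P m >] by exists n; apply/asboolP.
case: (ex_minnP exP) => m /asboolP Pm minm.
have mn : m <= n by apply: minm; apply/asboolP.
have ltm i : i < m -> ~ P i.
  by move=> ilt Pi; move: ilt; rewrite ltnNge minm //; apply/asboolP.
(* Time 0 is excluded by [nP0], so the phase changes between [m] and [m.+1], and that transition
   supplies the final and initial conditions. *)
case: m Pm minm mn ltm => // m Pm _ mn ltm.
have [fin1 ini2] : holds (r1 m.+1) (afinal A1) /\ holds (r2 m.+1) (ainit A2).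
  by case: (tr _ mn) => [[_ _]|[/(ltm _ (ltnSn m))]] //; apply.
apply: Or33; exists (take m.+1 w), (drop m.+1 w); rewrite cat_take_drop.
move: pw; rewrite -{1}(cat_take_drop m.+1 w) => /presents_cat[p1 p2].
rewrite size_takel // in p2; split=> //.
- exists D, sigma, r1; split=> //; rewrite size_takel //; split=> //.
    by move=> i j ile jle; apply: ag1; apply: leq_trans mn.
  by move=> i ilt; apply: tr1; [apply: leq_trans mn|apply: ltm].
(* The second run starts in the state reached after the first [m.+1] letters, so times are shifted
   by [m.+1]. *)
- exists D, (fun i => sigma (m.+1 + i)), (fun i => r2 (m.+1 + i)).
  rewrite size_drop -/n; split=> //; last by rewrite subnKC.
  have le i : i <= n - m.+1 -> m.+1 + i <= n.
    by move=> ile; rewrite -(subnKC mn) leq_add2l.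
  split=> [i j ile jle||i ilt]; first by apply: ag2; apply: le.
    by rewrite addn0.
  by rewrite addnS; apply: tr2; [rewrite -addnS; apply: le|
    apply: up Pm; [rewrite leq_addr|apply/le/ltnW]].
Qed.

End Concat.

Theorem theorem4 (S : finType) (Sg : signature S) (T : theory Sg)
    (L1 L2 : set (seq (structure Sg))) :
  is_language T L1 -> is_language T L2 ->
  regular T L1 -> regular T L2 ->
  regular T (concat T L1 L2).
Proof.
move=> _ _ [A1 ->] [A2 ->].
(* The booleans decide classically whether the empty word lies in each language. *)
exists (concat_automaton A1 A2 `[< lang A1 T [::] >] `[< lang A2 T [::] >]).
apply/seteqP; split=> w [Tw].
- move=> [w1 [w2 [ew l1 l2]]]; split=> //; subst w.
  have [e1|n1] := posnP (size w1).
    move: l1; rewrite (size0nil e1) => l1.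
    by apply: accepts_concat2; [apply/asboolP|exact: l2.2].
  have [e2|n2] := posnP (size w2).
    move: l2; rewrite (size0nil e2) cats0 => l2.
    by apply: accepts_concat1; [apply/asboolP|exact: l1.2].
  exact: accepts_concat_cat Tw n1 n2 l1.2 l2.2.
- move=> /accepts_concat_inv[[/asboolP e2 acc]|[/asboolP e1 acc]|].
  + by split=> //; exists w, [::]; rewrite cats0.
  + by split=> //; exists [::], w.
  + move=> [w1 [w2 [ew acc1 acc2]]]; split=> //; exists w1, w2.
    (* Acceptance alone does not give membership in [lang]; that the factors are words over [T] is
       inherited from [w]. *)
    by move: Tw; rewrite ew => /words_cat[T1 T2]; split.
Qed.
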